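(* Let $\mathcal C$ be an $N$-dimensional asymptotic class and let $\mathcal D$ be a class of finite $L'$-structures uniformly parameter-interpreted in $\mathcal C$ by an interpretation $\mathcal I$ of arity $r$. Assume that $\mathcal I$ is quotient-trace reflecting, or more generally that it satisfies the profile-descent hypotheses (i) and (ii) of the context. Suppose that for every $e\in\mathscr E_Q$ there is a realized descended profile exponent $d/e\in\Sigma_{\mathcal I}$ with $\gcd(d,e)=1$. Then $L_Q=L_{\rm vis}(\mathcal I)$, so $L_Q$ is the least asymptotic denominator of $\mathcal D$, i.e. the least $h\ge1$ such that $\mathcal D$ is an $h$-dimensional asymptotic class.
   Context: Conventions. Languages $L,L'$ are countable first-order languages, possibly with finitely many sorts; function and constant symbols may be replaced by graph relations. All structures in the classes considered are finite, and $|M|$ is the total number of elements (summed over sorts). Uniform little-$o$. For a collection $\Phi$ (a ''cell'') of pairs $(M,\bar a)$, $f=o(g)$ uniformly on $\Phi$ means: for every $\varepsilon>0$ there is $Q$ with $|f(M,\bar a)|\le\varepsilon g(M,\bar a)$ for all $(M,\bar a)\in\Phi$ with $|M|>Q$. $N$-dimensional asymptotic class ($N\ge1$). A class $\mathcal C$ of finite $L$-structures such that for every $L$-formula $\varphi(x;\bar y)$ with a single object variable $x$ there are a finite set $D_\varphi\subseteq(\{0,\dots,N\}\times\mathbb R_{>0})\cup\{(0,0)\}$ and, for each $(d,\mu)\in D_\varphi$, a parameter-free $L$-formula $\theta_{d,\mu}(\bar y)$ such that in every $M\in\mathcal C$ the sets $\theta_{d,\mu}(M^{|\bar y|})$ partition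 $M^{|\bar y|}$, and, uniformly on the cell $\{(M,\bar a):M\models\theta_{d,\mu}(\bar a)\}$, $|\varphi(M;\bar a)|=\mu|M|^{d/N}+o(|M|^{d/N})$; for $(0,0)$ this means $|\varphi(M;\bar a)|=o(1)$. Uniform parameter-interpretation $\mathcal I$ of $\mathcal D$ in $\mathcal C$, of arity $r\ge1$: an injection $\alpha:\mathcal D\to\mathcal C$; an integer $s\ge0$; fixed $L$-formulas $\delta(\bar u;\bar z)$, $\epsilon(\bar u,\bar v;\bar z)$ with $|\bar u|=|\bar v|=r$, $|\bar z|=s$; for each relation symbol $R\in L'$ a fixed $L$-formula $R^{\mathcal I}$ on the appropriate number of $r$-tuples (and $\bar z$); and for each $A\in\mathcal D$ a tuple $\bar c_A\in\alpha(A)^s$ and an $L'$-isomorphism $\iota_A:A\to X_A/E_A$, where $X_A=\delta(\alpha(A)^r;\bar c_A)$ and $E_A$ is the equivalence relation on $X_A$ defined by $\epsilon(\bar u,\bar v;\bar c_A)$; the formulas $R^{\mathcal I}$ (evaluated at $\bar c_A$) are $E_A$-invariant on $X_A$ and induce the $L'$-structure on $X_A/E_A$. A representative of $a\in A$ is an element of the class $\iota_A(a)$. Quotient-trace reflecting: for every $m\ge0$ and every parameter-free $L$-formula $\rho(\bar v_1,\dots,\bar v_m;\bar z)$ (each $\bar v_i$ an $r$-tuple) such that, for every $A\in\mathcal D$, $\rho(\cdot;\bar c_A)$ is $E_A$-invariant in each $\bar v_i$ on $X_A^m$, there is a parameter-free $L'$-formula $\rho^{\downarrow}(y_1,\dots,y_m)$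 such that for every $A\in\mathcal D$, all $a_1,\dots,a_m\in A$ and arbitrary representatives $\bar v_i\in X_A$ of $a_i$: $A\models\rho^{\downarrow}(a_1,\dots,a_m)\iff\alpha(A)\models\rho(\bar v_1,\dots,\bar v_m;\bar c_A)$. Quotient-universe partition, $\mathscr E_Q$ and $L_Q$. There is a finite family of parameter-free $L$-formulas $\chi_{e,\lambda}(\bar z)$, indexed by pairs $(e,\lambda)\in(\{0,\dots,Nr\}\times\mathbb R_{>0})\cup\{(0,0)\}$, such that for each $A\in\mathcal D$ exactly one $\chi_{e,\lambda}(\bar c_A)$ holds in $M=\alpha(A)$, and uniformly on each cell $|A|=|X_A/E_A|=\lambda|M|^{e/N}+o(|M|^{e/N})$ (as $|M|\to\infty$). Fix such a partition. Let $\mathscr E_Q$ be the set of positive $e$ for which, for some $\lambda>0$, the structures $A\in\mathcal D$ with $\alpha(A)\models\chi_{e,\lambda}(\bar c_A)$ have unbounded cardinality. Then $L_Q=\operatorname{lcm}(\mathscr E_Q)$, with $\operatorname{lcm}(\varnothing)=1$. Ambient quotient-counting partition for an $L'$-formula $\varphi(x;y_1,\dots,y_m)$ with one object variable: finitely many parameter-free $L$-formulas $\theta_i(\bar v_1,\dots,\bar v_m;\bar z)$, $i\in I$, with labels $(d_i,\mu_i)\in(\{0,\dots,Nr\}\times\mathbb R_{>0})\cup\{(0,0)\}$, such that for each $A\in\mathcal D$ the formulas $\theta_i(\cdot;\bar c_A)$ partition $X_A^m$ and, uniformly over all $A\in\mathcal D$ and $\bar b\in A^m$ having a representative tuple $\bar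 v\in X_A^m$ with $\alpha(A)\models\theta_i(\bar v;\bar c_A)$, $|\varphi(A;\bar b)|=\mu_i|M|^{d_i/N}+o(|M|^{d_i/N})$, $M=\alpha(A)$ (meaning $o(1)$ for label $(0,0)$). (Such partitions always exist.) The profile of $\bar b\in A^m$ is the nonempty set $P\subseteq I$ of all $i$ such that some representative tuple of $\bar b$ satisfies $\theta_i(\cdot;\bar c_A)$ in $\alpha(A)$. Profile-descent hypotheses: (i) for each cell $\chi_{e,\lambda}$ there is a parameter-free $L'$-sentence true in $A$ iff $\alpha(A)\models\chi_{e,\lambda}(\bar c_A)$, for all $A\in\mathcal D$; (ii) for each $\varphi(x;\bar y)$ one can choose an ambient quotient-counting partition such that for each nonempty $P\subseteq I$ there is a parameter-free $L'$-formula defining, in every $A\in\mathcal D$, the set of $\bar b$ with profile $P$. (Quotient-trace reflection implies (i) and (ii).) Realized descended profile exponents and visible denominator. For each $\varphi$ fix such a partition (one as in (ii)). For a universe cell $(e,\lambda)$ and a profile $P$, consider the joint cell of all $(A,\bar b)$ with $\alpha(A)\models\chi_{e,\lambda}(\bar c_A)$ and $\bar b$ of profile $P$. If $|A|$ is unbounded on this joint cell then $e>0$ and all labels in $P$ coincide; if the common label is $(d,\mu)$ with $\mu>0$, the fraction $d/e$ is said to occur (one has $0\le d\le e$). Let $\Sigma_{\mathcal I}$ be the set of all fractions $d/e$ that occur in this way as $\varphi$ varies over all $L'$-formulas. Put $L_{\rm vis}(\mathcal I)=\operatorname{lcm}\{e/\gcd(d,e): d/e\in\Sigma_{\mathcal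 I}\}$, with $\operatorname{lcm}(\varnothing)=1$. *)

(* Defs.v *)
From HB Require Import structures.
From mathcomp Require Import all_boot all_order all_algebra.
From mathcomp Require Import boolp classical_sets fsbigop reals exp.

Set Implicit Arguments.
Unset Strict Implicit.
Unset Printing Implicit Defensive.

Import Order.TTheory GRing.Theory Num.Theory.

(* Countable relational languages with finitely many sorts; functions and
   constants are represented by their graphs. *)
Record language := Language {
  sort : finType;
  rel_symb : countType;
  rel_sorts : rel_symb -> seq sort
}.

Definition arity (L : language) (Rl : rel_symb L) : nat := size (rel_sorts Rl).

(* The universe of a many-sorted structure is the disjoint union of its sorts,
   so that its cardinal is the total number of elements. *)
Record structure (L : language) := Structure {
  carrier :> finType;
  sort_of : carrier -> sort L;
  interp : forall Rl : rel_symb L, pred ((arity Rl).-tuple carrier);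
  interp_sorted : forall (Rl : rel_symb L) (t : (arity Rl).-tuple carrier),
    interp t -> map sort_of t = rel_sorts Rl
}.

(* [formula L V] is the type of formulas whose free variables are in V; a
   quantifier binds the variable [None] of [option V].  Variables range over
   the total universe, and a variable is restricted to a sort by means of the
   atomic formula [FSort]; as there are finitely many sorts, this has the same
   expressive power as sorted variables. *)
Inductive formula (L : language) (V : Type) : Type :=
| FFalse
| FEq of V & V
| FSort of sort L & V
| FRel (Rl : rel_symb L) of (arity Rl).-tuple V
| FImp of formula L V & formula L V
| FAll of formula L (option V).

Fixpoint sat (L : language) (M : structure L) (V : Type) (phi : formula L V) :
    (V -> M) -> bool :=
  match phi with
  | FFalse => fun _ => false
  | FEq x y => fun a => a x == a y
  | FSort s x => fun a => sort_of (a x) == s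
  | FRel Rl t => fun a => interp [tuple of map a t]
  | FImp psi chi => fun a => sat psi a ==> sat chi a
  | FAll psi => fun a => [forall x : M, sat psi (oapp a x)]
  end.

(* A formula phi(x; y_1, ..., y_m) is a [formula L (option 'I_m)], the object
   variable x being [None]. *)
Definition solutions (L : language) (M : structure L) (m : nat)
    (phi : formula L (option 'I_m)) (a : m.-tuple M) : {set M} :=
  [set x : M | sat phi (oapp (tnth a) x)]%SET.

Definition class (L : language) := structure L -> Prop.

Record member (L : language) (C : class L) := Member {
  member_structure :> structure L;
  memberP : C member_structure
}.

Section Asymptotics.
Variable R : realType.
Local Open Scope ring_scope.

Definition little_o (T : Type) (size : T -> nat) (Phi : T -> Prop)
    (f g : T -> R) : Prop :=
  forall eps : R, 0 < eps -> exists Q : nat,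
    forall t : T, Phi t -> (Q < size t)%N -> `|f t| <= eps * g t.

Definition valid_label (n : nat) (l : nat * R) : bool :=
  ((l.1 <= n)%N && (0 < l.2)) || (l == (0%N, 0)).

(* f = mu size^(d/N) + o(size^(d/N)) uniformly on Phi, where l = (d, mu); for
   l = (0, 0) this reads f = o(1), since x `^ 0 = 1. *)
Definition asymptotic_to (T : Type) (size : T -> nat) (Phi : T -> Prop)
    (f : T -> nat) (N : nat) (l : nat * R) : Prop :=
  little_o size Phi
    (fun t => (f t)%:R - l.2 * (size t)%:R `^ (l.1%:R / N%:R))
    (fun t => (size t)%:R `^ (l.1%:R / N%:R)).

Definition asymptotic_class (N : nat) (L : language) (C : class L) : Prop :=
  forall (m : nat) (phi : formula L (option 'I_m)),
  exists (D : seq (nat * R)) (theta : nat * R -> formula L 'I_m),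
  [/\ all (valid_label N) D,
      forall (M : member C) (a : m.-tuple M),
        exists! l, l \in D /\ sat (theta l) (tnth a)
    & forall l, l \in D ->
        asymptotic_to
          (fun t : {M : member C & m.-tuple M} => #|projT1 t|)
          (fun t => sat (theta l) (tnth (projT2 t)))
          (fun t => #|solutions phi (projT2 t)|)
          N l].

Definition least_asymptotic_denominator (L : language) (D : class L)
    (l : nat) : Prop :=
  [/\ (0 < l)%N, asymptotic_class l D
    & forall h : nat, (0 < h)%N -> asymptotic_class h D -> (l <= h)%N].

End Asymptotics.

Definition unbounded (T : Type) (size : T -> nat) (Phi : T -> Prop) : Prop :=
  forall K : nat, exists2 t : T, Phi t & (K < size t)%N.

(* Variables of a formula rho(v_1, ..., v_m; z) in which every v_i is an
   r-tuple and z is an s-tuple. *)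
Definition block_env (M : Type) (m r s : nat) (v : m.-tuple (r.-tuple M))
    (c : s.-tuple M) (x : 'I_m * 'I_r + 'I_s) : M :=
  match x with
  | inl (i, k) => tnth (tnth v i) k
  | inr j => tnth c j
  end.

(* [iota A] sends an element of A to a class of r-tuples, i.e. to the set of
   its representatives.  The sorts of L' are interpreted in the same way as
   unary relation symbols. *)
Record interp_data (L L' : language) (C : class L) (D : class L') (r : nat) :=
InterpData {
  alpha : member D -> member C;
  nparam : nat;
  delta : formula L ('I_1 * 'I_r + 'I_nparam);
  epsilon : formula L ('I_2 * 'I_r + 'I_nparam);
  sortI : sort L' -> formula L ('I_1 * 'I_r + 'I_nparam);
  relI : forall Rl : rel_symb L', formula L ('I_(arity Rl) * 'I_r + 'I_nparam);
  param : forall A : member D, nparam.-tuple (alpha A);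
  iota : forall A : member D, A -> {set r.-tuple (alpha A)}
}.

Section Interpretation.
Variables (L L' : language) (C : class L) (D : class L') (r : nat).
Variable I : interp_data C D r.

Definition block_formula (m : nat) := formula L ('I_m * 'I_r + 'I_(nparam I)).

Definition block_sat (A : member D) (m : nat) (rho : block_formula m)
    (v : m.-tuple (r.-tuple (alpha I A))) : bool :=
  sat rho (block_env v (param I A)).

Definition dom (A : member D) : {set r.-tuple (alpha I A)} :=
  [set u | block_sat (delta I) [tuple u]]%SET.

Definition equ (A : member D) : rel (r.-tuple (alpha I A)) :=
  [rel u v | block_sat (epsilon I) [tuple u; v]].

Definition in_dom (A : member D) (m : nat)
    (v : m.-tuple (r.-tuple (alpha I A))) : bool :=
  [forall i, tnth v i \in dom A].

Definition invariant_formula (m : nat) (rho : block_formula m) : Prop :=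
  forall (A : member D) (v w : m.-tuple (r.-tuple (alpha I A))),
    in_dom v -> in_dom w -> (forall i, equ (tnth v i) (tnth w i)) ->
    block_sat rho v = block_sat rho w.

Definition represents (A : member D) (m : nat)
    (v : m.-tuple (r.-tuple (alpha I A))) (b : m.-tuple A) : bool :=
  [forall i, tnth v i \in iota I (tnth b i)].

Record is_interpretation : Prop := IsInterpretation {
  alpha_inj : injective (alpha I);
  equ_equivalence : forall A, {in dom A & &, equivalence_rel (@equ A)};
  iota_inj : forall A, injective (@iota _ _ _ _ _ I A);
  iota_image : forall A,
    [set iota I (A := A) a | a in [set: A]]%SET = equivalence_partition (@equ A) (dom A);
  sortI_invariant : forall s, @invariant_formula 1 (sortI I s);
  relI_invariant : forall Rl, @invariant_formula (arity Rl) (relI I Rl);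
  iota_sort : forall s (A : member D) (a : A) u, u \in iota I a ->
    (sort_of a == s) = block_sat (sortI I s) [tuple u];
  iota_rel : forall Rl (A : member D) (b : (arity Rl).-tuple A) v,
    represents v b -> interp b = block_sat (relI I Rl) v
}.

End Interpretation.

Record interpretation (L L' : language) (C : class L) (D : class L')
    (r : nat) := Interpretation {
  interpretation_data :> interp_data C D r;
  interpretationP : is_interpretation interpretation_data
}.

Section Descent.
Variables (R : realType) (N : nat) (L L' : language).
Variables (C : class L) (D : class L') (r : nat).
Variable I : interpretation C D r.
Local Open Scope ring_scope.

Definition quotient_trace_reflecting : Prop :=
  forall (m : nat) (rho : block_formula I m), invariant_formula rho ->
  exists rho' : formula L' 'I_m,
    forall (A : member D) (b : m.-tuple A) v, represents v b ->
      sat rho' (tnth b) = block_sat rho v.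

Record universe_partition := UniversePartition {
  univ_labels : seq (nat * R);
  chi : nat * R -> formula L 'I_(nparam I);
  univ_labels_valid : all (valid_label (N * r)) univ_labels;
  univ_cell_partition : forall A : member D,
    exists! l, l \in univ_labels /\ sat (chi l) (tnth (param I A));
  univ_cell_asymptotic : forall l, l \in univ_labels ->
    asymptotic_to (fun A => #|alpha I A|)
      (fun A => sat (chi l) (tnth (param I A))) (fun A => #|A|) N l
}.

Definition univ_cell (U : universe_partition) (l : nat * R) (A : member D) :
    bool :=
  sat (chi U l) (tnth (param I A)).

Record ambient_partition (m : nat) (phi : formula L' (option 'I_m)) :=
AmbientPartition {
  cell : finType;
  theta : cell -> block_formula I m;
  label : cell -> nat * R;
  label_valid : forall i, valid_label (N * r) (label i);
  theta_partition : forall (A : member D) v, in_dom v ->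
    exists! i, @block_sat _ _ _ _ _ I A m (theta i) v;
  theta_asymptotic : forall i,
    asymptotic_to
      (fun t : {A : member D & m.-tuple A} => #|alpha I (projT1 t)|)
      (fun t => exists2 v, represents v (projT2 t) & block_sat (theta i) v)
      (fun t => #|solutions phi (projT2 t)|)
      N (label i)
}.

Definition profile (m : nat) (phi : formula L' (option 'I_m))
    (Theta : ambient_partition phi) (A : member D) (b : m.-tuple A) :
    {set cell Theta} :=
  [set i | [exists v : m.-tuple (r.-tuple (alpha I A)),
              represents v b && block_sat (theta i) v]]%SET.

Definition ambient_family :=
  forall (m : nat) (phi : formula L' (option 'I_m)), ambient_partition phi.

Definition universe_descends (U : universe_partition) : Prop :=
  forall l, l \in univ_labels U ->
  exists sigma : formula L' 'I_0,
    forall A : member D, sat sigma (tnth [tuple of [::] : seq A]) =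
                         univ_cell U l A.

Definition profiles_descend (m : nat) (phi : formula L' (option 'I_m))
    (Theta : ambient_partition phi) : Prop :=
  forall P : {set cell Theta}, P != finset.set0 ->
  exists psi : formula L' 'I_m,
    forall (A : member D) (b : m.-tuple A),
      sat psi (tnth b) = (profile Theta b == P).

Definition profile_descent (U : universe_partition) (F : ambient_family) :
    Prop :=
  universe_descends U /\
  forall (m : nat) (phi : formula L' (option 'I_m)),
    profiles_descend (F m phi).

Definition E_Q (U : universe_partition) : set nat :=
  [set e | (0 < e)%N /\ exists lambda : R,
     [/\ 0 < lambda, (e, lambda) \in univ_labels U
       & unbounded (fun A : member D => #|A|) (univ_cell U (e, lambda))]
  ]%classic.

(* The finitely supported big operators in [L_Q] and [L_vis] do range over
   finite sets: every exponent e of a universe cell satisfies e <= N * r. *)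
Definition L_Q (U : universe_partition) : nat :=
  \big[lcmn/1%N]_(e \in E_Q U) e.

Definition occurs (U : universe_partition) (F : ambient_family)
    (d e : nat) : Prop :=
  exists (m : nat) (phi : formula L' (option 'I_m)) (lambda mu : R)
         (P : {set cell (F m phi)}),
  [/\ (0 < e)%N /\ (e, lambda) \in univ_labels U,
      P != finset.set0,
      unbounded (fun t : {A : member D & m.-tuple A} => #|projT1 t|)
        (fun t => univ_cell U (e, lambda) (projT1 t) /\
                  profile (F m phi) (projT2 t) = P),
      forall i, i \in P -> label i = (d, mu)
    & 0 < mu].

(* The fractions are rational numbers, not formal pairs (d, e). *)
Definition Sigma_I (U : universe_partition) (F : ambient_family) : set rat :=
  [set q | exists d e : nat, occurs U F d e /\ q = d%:R / e%:R]%classic.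

Definition L_vis (U : universe_partition) (F : ambient_family) : nat :=
  \big[lcmn/1%N]_(k \in [set k | exists d e : nat,
      [/\ (0 < e)%N, Sigma_I U F (d%:R / e%:R) & k = (e %/ gcdn d e)%N]
    ]%classic) k.

End Descent.

(* Main.v *)
(* |A| and |phi(A; b)| are both asymptotic to powers of n = |alpha(A)|.  On a
   joint cell where |A| is unbounded, solving |A| ~ lambda n^(e/N) for n gives
   |phi(A; b)| ~ mu lambda^(-d/e) |A|^(d/e), with e in E_Q and d <= e; so L_Q is
   an asymptotic denominator of D.  Joint cells where |A| is bounded impose
   nothing and may be given the label (0, 0).  Conversely, growth exponents
   along an unbounded cell are unique, so if D is h-dimensional then every
   realized d/e equals some d1/h; when gcd(d, e) = 1 this forces e to divide
   h. *)

Require Import Defs.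
From HB Require Import structures.
From mathcomp Require Import all_boot all_order all_algebra.
From mathcomp Require Import finmap ring lra.
From mathcomp Require Import boolp classical_sets cardinality fsbigop.
From mathcomp Require Import reals exp.

Set Implicit Arguments.
Unset Strict Implicit.
Unset Printing Implicit Defensive.

Import Order.TTheory GRing.Theory Num.Theory.

Local Open Scope ring_scope.

(** * Growth rates *)

Section Growth.
Variable T : Type.
Implicit Types (size n k : T -> nat) (Phi Psi : T -> Prop).

Lemma unboundedPn size Phi :
  ~ unbounded size Phi -> exists K : nat, forall t, Phi t -> (size t <= K)%N.
Proof.
move=> bdd; apply: contrapT => nK; apply: bdd => K.
apply: contrapT => nt; apply: nK; exists K => t Pt.
by rewrite leqNgt; apply/negP => Kt; apply: nt; exists t.
Qed.

(** If [size] were bounded on every piece, the maximum of these finitely many bounds would bound it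
    on [Phi]. *)
Lemma unbounded_pigeonhole (I : eqType) (s : seq I) (Psi : I -> T -> Prop)
    size Phi :
  (forall t, Phi t -> exists2 i, i \in s & Psi i t) -> unbounded size Phi ->
  exists2 i, i \in s & unbounded size (fun t => Phi t /\ Psi i t).
Proof.
move=> cover uPhi; apply: contrapT => nU.
have [K KP] : exists K, forall i, i \in s -> forall t, Phi t /\ Psi i t ->
    (size t <= K)%N.
  (* The bound is built by induction on a sublist, because [nU] concerns members of the full list
     [s]. *)
  have : {subset s <= s} by [].
  elim: {1 3}s => [|i s' IH] sub; first by exists 0%N.
  have [|K KP] := IH; first by move=> j js; rewrite sub // inE js orbT.
  have [|Ki KiP] := @unboundedPn size (fun t => Phi t /\ Psi i t).
    by move=> u; apply: nU; exists i => //; rewrite sub ?mem_head.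
  exists (maxn Ki K) => j; rewrite inE => /predU1P[->|js] t Pt; rewrite leq_max.
    by rewrite KiP.
  by rewrite (KP j) ?orbT.
have [t Pt Kt] := uPhi K; have [i si Pit] := cover _ Pt.
by move: Kt; rewrite ltnNge (KP i).
Qed.

(** Transfers estimates valid for large [n] (the ambient size) to the region where [k] (the
    interpreted size) is large. *)
Definition diverges_with n k Phi := forall Q, exists Q',
  forall t, Phi t -> (Q' < k t)%N -> (Q < n t)%N.

Lemma diverges_with_unbounded n k Phi :
  diverges_with n k Phi -> unbounded k Phi -> unbounded n Phi.
Proof.
move=> nk uk Q; have [Q' Q'P] := nk Q.
by have [t Pt /(Q'P t Pt)] := uk Q'; exists t.
Qed.

Variable R : realType.
Implicit Types (f g : T -> nat) (a b mu nu : R).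

(** This is [asymptotic_to] with an arbitrary real exponent; the two unfold to the same
    statement. *)
Definition grows_like size Phi f a mu := little_o size Phi
  (fun t => (f t)%:R - mu * (size t)%:R `^ a) (fun t => (size t)%:R `^ a).

Lemma little_o_sub size Phi Psi (u v : T -> R) :
  (forall t, Phi t -> Psi t) -> little_o size Psi u v -> little_o size Phi u v.
Proof.
by move=> sub o eps /o [Q QP]; exists Q => t /sub; apply: QP.
Qed.

Lemma little_o_bounded size Phi (u v : T -> R) :
  ~ unbounded size Phi -> little_o size Phi u v.
Proof.
move=> /unboundedPn[K KP] eps _; exists K => t /KP; rewrite leqNgt.
by move=> /negP.
Qed.

Lemma little_o_union (I : eqType) (s : seq I) (Psi : I -> T -> Prop)
    size Phi (u v : T -> R) :
  (forall t, Phi t -> exists2 i, i \in s & Psi i t) ->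
  (forall i, i \in s -> little_o size (Psi i) u v) -> little_o size Phi u v.
Proof.
move=> cover o eps eps0.
have [Q QP] : exists Q, forall i, i \in s -> forall t, Psi i t ->
    (Q < size t)%N -> `|u t| <= eps * v t.
  elim: s o {cover} => [|i s IH] o; first by exists 0%N.
  have [j js|Q QP] := IH; first by apply: o; rewrite inE js orbT.
  have [Qi QiP] := o i (mem_head _ _) _ eps0.
  exists (maxn Qi Q) => j; rewrite inE => /predU1P[->|js] t Pt.
    by rewrite gtn_max => /andP[? _]; apply: QiP.
  by rewrite gtn_max => /andP[_ ?]; apply: (QP j).
by exists Q => t /cover[i si Pit]; apply: QP Pit.
Qed.

(** With error 1, [k] is at most [|nu| + 1] once [n] is large, and [n] is large once [k] is. Hence
    an unbounded universe cell has a positive exponent. *)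
Lemma grows_like_const_bounded n k Phi nu :
  diverges_with n k Phi -> grows_like n Phi k 0 nu -> ~ unbounded k Phi.
Proof.
move=> nk kn uk; have [Q QP] := kn 1 ltr01; have [Q' Q'P] := nk Q.
have [t Pt] := uk (maxn Q' (Num.bound (`|nu| + 1))).
rewrite gtn_max => /andP[/(Q'P _ Pt) Qt kt].
have := QP _ Pt Qt; rewrite powRr0 !mulr1 => fnu.
have k_le : (k t)%:R <= `|nu| + 1.
  rewrite addrC -lerBlDr (le_trans _ fnu) // -{1}(normr_nat R (k t)).
  exact: lerB_dist.
have bnd : `|nu| + 1 < (Num.bound (`|nu| + 1))%:R.
  by apply: archi_boundP; rewrite addr_ge0.
have := lt_trans (le_lt_trans k_le bnd); rewrite -!(ltr_nat R) in kt *.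
by move=> /(_ _ kt); rewrite ltxx.
Qed.

(** If [b < a], then [f / n^b] is eventually at least [mu / 2 * n^(a - b)], which outgrows the bound
    [nu + 1] on [g / n^b]. Taking [f = g] in both directions yields uniqueness of exponents. *)
Lemma le_exponent size Phi f g a b mu nu :
  unbounded size Phi -> (forall t, Phi t -> (f t <= g t)%N) ->
  0 < mu -> 0 <= nu ->
  grows_like size Phi f a mu -> grows_like size Phi g b nu -> a <= b.
Proof.
move=> uPhi fg mu0 nu0 fa gb; rewrite leNgt; apply/negP => ba.
have mu2 : 0 < mu / 2 by rewrite divr_gt0.
have [Q1 Q1P] := fa _ mu2; have [Q2 Q2P] := gb _ ltr01.
(* [X] solves [mu / 2 * X = nu + 1], and [n > B] forces [n^(a - b) > X]. *)
pose X := 2 * (nu + 1) / mu.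
have X0 : 0 < X by rewrite !mulr_gt0 ?invr_gt0 //; lra.
pose B := Num.bound (X `^ (a - b)^-1).
have [t Pt] := uPhi (maxn Q1 (maxn Q2 B)).
rewrite !gtn_max => /and3P[Q1t Q2t Bt].
have := Q1P _ Pt Q1t; have := Q2P _ Pt Q2t.
set n : R := (size t)%:R.
have n0 : 0 < n by rewrite ltr0n (leq_ltn_trans _ Bt).
have ->: n `^ a = n `^ b * n `^ (a - b).
  by rewrite -powRD ?(gt_eqF n0) ?implybT // addrC subrK.
rewrite !ler_norml => /andP[_ g_le] /andP[f_ge _].
have {fg} fg : (f t)%:R <= (g t)%:R :> R by rewrite ler_nat fg.
have y0 : 0 < n `^ b by rewrite powR_gt0.
have Xn : X < n `^ (a - b).
  have Bn : X `^ (a - b)^-1 < n.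
    apply: lt_trans (_ : B%:R < n); last by rewrite ltr_nat.
    by apply: archi_boundP; rewrite powR_ge0.
  have -> : X = (X `^ (a - b)^-1) `^ (a - b).
    by rewrite -powRrM mulVf ?powRr1 ?(ltW X0) // gt_eqF ?subr_gt0.
  by apply: gt0_ltr_powR; rewrite ?nnegrE ?subr_gt0 ?powR_ge0 ?(ltW n0).
have : mu / 2 * n `^ (a - b) <= nu + 1.
  rewrite -(ler_pM2l y0); set z := n `^ (a - b) in f_ge *.
  set y := n `^ b in f_ge g_le *.
  have -> : y * (mu / 2 * z) = mu * (y * z) - mu / 2 * (y * z) by field.
  by rewrite mulrDr mulr1; lra.
apply/negP; rewrite -ltNge.
have -> : nu + 1 = mu / 2 * X by rewrite /X; field; rewrite (gt_eqF mu0).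
by rewrite ltr_pM2l.
Qed.

(** For an exponent in [0, 1], [x^q] lies between 1 and [x]. *)
Lemma normB1_powR_le (x q : R) :
  0 < x -> 0 <= q <= 1 -> `|x `^ q - 1| <= `|x - 1|.
Proof.
move=> x0 /andP[q0 q1]; have [x1|x1] := leP 1 x.
  have := ler1_powR x1 q1; have := ler_powR x1 q0; rewrite powRr0 => xq1 xqx.
  by rewrite !ger0_norm ?subr_ge0 // lerD2r.
have xx : 0 < x <= 1 by rewrite x0 ltW.
have := ger_powR xx q0; have := ger_powR xx q1.
rewrite powRr0 powRr1 ?(ltW x0) // => xxq xq1.
by rewrite !ler0_norm ?subr_le0 ?(ltW x1) // !opprB lerD2l lerN2.
Qed.

(* Writing k = nu n^b x with x close to 1, we have n^a = nu^(-q) x^(-q) k^q for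
   q = a/b, and |x^q - 1| <= |x - 1| because q <= 1. *)
Lemma grows_like_change_scale n k Phi f a b mu nu :
  0 <= a <= b -> 0 < b -> 0 <= mu -> 0 < nu -> diverges_with n k Phi ->
  grows_like n Phi f a mu -> grows_like n Phi k b nu ->
  grows_like k Phi f (a / b) (mu * nu `^ (- (a / b))).
Proof.
move=> /andP[a0 ab] b0 mu0 nu0 nk fa kb eps eps0; set q := a / b.
have q01 : 0 <= q <= 1 by rewrite divr_ge0 ?(ltW b0) // ler_pdivrMr // mul1r.
set c := mu * _; have c0 : 0 <= c by rewrite mulr_ge0 // powR_ge0.
have w0 : 0 < nu `^ q by rewrite powR_gt0.
(* The bound 1/2 keeps both [x] and [x^q] above 1/2; the other gives [c * eta <= eps / 4], with
   [c + 1] guarding against [c = 0]. *)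
pose eta := Num.min (1 / 2) (eps / (4 * (c + 1))).
have eta0 : 0 < eta by rewrite lt_min !divr_gt0 //; lra.
have eta_le : eta <= 1 / 2 by rewrite ge_min lexx.
have ceta : c * eta <= eps / 4.
  have : eta <= eps / (4 * (c + 1)) by rewrite ge_min lexx orbT.
  rewrite ler_pdivlMr; last by lra.
  nra.
have ew0 : 0 < eps * nu `^ q / 4 by rewrite divr_gt0 // mulr_gt0.
have [Q1 Q1P] := fa _ ew0.
have [Q2 Q2P] := kb _ (mulr_gt0 eta0 nu0).
have [Q QP] := nk (maxn Q1 Q2).
exists Q => t Pt /(QP _ Pt); rewrite gtn_max => /andP[Q1t Q2t].
have := Q1P _ Pt Q1t; have := Q2P _ Pt Q2t.
set m : R := (n t)%:R; set K : R := (k t)%:R; set F : R := (f t)%:R.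
have m0 : 0 < m by rewrite ltr0n (leq_ltn_trans _ Q1t).
have z0 : 0 < m `^ b by rewrite powR_gt0.
set y := nu * m `^ b; have y0 : 0 < y by rewrite mulr_gt0.
pose x := K / y; have Kxy : K = x * y by rewrite divfK // gt_eqF.
have yq : y `^ q = nu `^ q * m `^ a.
  by rewrite powRM ?ltW // -powRrM /q mulrCA divff ?mulr1 // gt_eqF.
rewrite -(mulrA eta) -/y => kxy.
have xeta : `|x - 1| <= eta.
  by rewrite -(ler_pM2r y0) -{1}(gtr0_norm y0) -normrM mulrBl mul1r -Kxy.
have x_ge : 1 / 2 <= x by move: xeta; rewrite ler_norml => /andP[? _]; lra.
have x0 : 0 < x by lra.
have := le_trans (normB1_powR_le x0 q01) xeta.
have -> : K `^ q = x `^ q * y `^ q by rewrite Kxy powRM // ltW.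
have u0 : 0 < y `^ q by rewrite powR_gt0.
have cw : c * nu `^ q = mu by rewrite /c powRN divfK // gt_eqF.
rewrite {x0 x_ge xeta kxy Kxy}yq in u0 *.
move: (x `^ q) (m `^ a) (nu `^ q) w0 cw u0 => X A W W0 <- WA0.
have A0 : 0 < A by rewrite pmulr_rgt0 in WA0.
rewrite !ler_norml => /andP[X1 X2] /andP[F1 F2].
have X3 : 1 / 2 <= X by lra.
set V := W * A in WA0 *.
have FE : c * W * A = c * V by rewrite /V mulrA.
have E2 : eps * W / 4 * A = eps / 4 * V by rewrite /V; field.
rewrite FE E2 in F1 F2.
(* Here [V = y^q] and [X = x^q]. The error of [f] and the error from replacing [V] by [X * V] are
   each at most [eps / 4 * V]; their sum [eps / 2 * V] is at most [eps * (X * V)]. *)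
have h1 : V <= 2 * (X * V) by nra.
have h2 : `|c * V - c * (X * V)| <= eps / 4 * V.
  have -> : c * V - c * (X * V) = - (c * (X - 1) * V) by ring.
  rewrite normrN normrM (gtr0_norm WA0) normrM (ger0_norm c0) ler_pM2r //.
  by apply: le_trans ceta; apply: ler_wpM2l => //; rewrite ler_norml; lra.
move: h2; rewrite ler_norml => /andP[h2 h3].
have h4 : eps / 2 * V <= eps / 2 * (2 * (X * V)).
  by rewrite ler_pM2l // divr_gt0.
have h5 : eps / 2 * (2 * (X * V)) = eps * (X * V) by field.
rewrite h5 in h4.
by apply/andP; split; lra.
Qed.

End Growth.
(** * Definability *)

Section Formulas.
Variable L : language.
Implicit Types (V W : Type) (M : structure L).

Fixpoint rename V W (f : V -> W) (phi : formula L V) : formula L W :=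
  match phi with
  | FFalse => FFalse L W
  | FEq x y => FEq L (f x) (f y)
  | FSort s x => FSort s (f x)
  | FRel Rl t => FRel (Rl := Rl) [tuple of map f t]
  | FImp psi chi => FImp (rename f psi) (rename f chi)
  | FAll psi => FAll (rename (omap f) psi)
  end.

Lemma sat_rename M V W (f : V -> W) (phi : formula L V) (a : W -> M) :
  sat (rename f phi) a = sat phi (a \o f).
Proof.
elim: phi W f a => {V}
  [V|V x y|V s x|V Rl t|V psi IH1 chi IH2|V psi IH] W f a //=.
- by congr interp; apply: val_inj; rewrite /= -map_comp.
- by rewrite IH1 IH2.
- apply: eq_forallb => x; rewrite IH; congr sat.
  by apply: funext => -[].
Qed.

Definition FNot V (phi : formula L V) := FImp phi (FFalse L V).
Definition FAnd V (phi psi : formula L V) := FNot (FImp phi (FNot psi)).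
Definition FOr V (phi psi : formula L V) := FImp (FNot phi) psi.
Definition FAllOf V (s : seq (formula L V)) :=
  foldr (@FAnd V) (FNot (FFalse L V)) s.
Definition FOneOf V (s : seq (formula L V)) := foldr (@FOr V) (FFalse L V) s.

Lemma sat_FNot M V (phi : formula L V) (a : V -> M) :
  sat (FNot phi) a = ~~ sat phi a.
Proof. by rewrite /= implybF. Qed.

Lemma sat_FAnd M V (phi psi : formula L V) (a : V -> M) :
  sat (FAnd phi psi) a = sat phi a && sat psi a.
Proof. by rewrite /=; do 2!case: sat. Qed.

Lemma sat_FOr M V (phi psi : formula L V) (a : V -> M) :
  sat (FOr phi psi) a = sat phi a || sat psi a.
Proof. by rewrite /=; do 2!case: sat. Qed.

Lemma sat_FAllOf M V (s : seq (formula L V)) (a : V -> M) :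
  sat (FAllOf s) a = all (fun phi => sat phi a) s.
Proof. by elim: s => //= phi s <-; do 2!case: sat. Qed.

Lemma sat_FOneOf M V (s : seq (formula L V)) (a : V -> M) :
  sat (FOneOf s) a = has (fun phi => sat phi a) s.
Proof. by elim: s => //= phi s <-; do 2!case: sat. Qed.

(* The type of variables does not change: the variables in [s] simply become
   irrelevant, which allows iteration. *)
Definition FExOf (V : eqType) (s : seq V) (phi : formula L V) : formula L V :=
  foldr (fun x psi =>
    FNot (FAll (FNot (rename (fun y => if y == x then None else Some y) psi))))
    phi s.

Lemma sat_FExOf M (V : eqType) (s : seq V) (phi : formula L V) (a : V -> M) :
  sat (FExOf s phi) a <->
  exists2 a' : V -> M, (forall x, x \notin s -> a' x = a x) & sat phi a'.
Proof.
elim: s a => [|x s IH] a /=.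
  split=> [sa|[a' aa' sa]]; first by exists a.
  by rewrite -(_ : a' = a) //; apply: funext => x; apply: aa'.
rewrite implybF negb_forall; split.
  case/existsP => c; rewrite implybF negbK sat_rename => /IH[a' aa' sa].
  exists a' => // y; rewrite inE negb_or => /andP[yx ys].
  by rewrite aa' //= (negPf yx).
case=> a' aa' sa; apply/existsP; exists (a' x).
rewrite implybF negbK sat_rename; apply/IH; exists a' => // y ys /=.
by have [->|yx] := eqVneq y x => //=; rewrite aa' // inE negb_or yx.
Qed.

End Formulas.

(** * Representatives of elements and of tuples *)

Section Interpretation.
Variables (L L' : language) (C : class L) (D : class L') (r : nat).
Variable I : interpretation C D r.
Implicit Types A : member D.

Lemma iotaP A (a : A) u : u \in Defs.iota I a ->
  u \in dom I A /\ forall w, (w \in Defs.iota I a) = (w \in dom I A) && equ u w.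
Proof.
have : Defs.iota I a \in equivalence_partition (@equ _ _ _ _ _ I A) (dom I A).
  by rewrite -(iota_image (interpretationP I)) imset_f // inE.
case/imsetP => x xD ->; rewrite inE => /andP[uD xu]; split=> // w.
rewrite inE; have [wD|//] := boolP (w \in dom I A).
by have [_] := equ_equivalence (interpretationP I) xD uD wD; move/(_ xu) ->.
Qed.

Lemma iota_nonempty A (a : A) : exists u, u \in Defs.iota I a.
Proof.
have : Defs.iota I a \in equivalence_partition (@equ _ _ _ _ _ I A) (dom I A).
  by rewrite -(iota_image (interpretationP I)) imset_f // inE.
case/imsetP => x xD ->; exists x; rewrite inE xD /=.
by have [->] := equ_equivalence (interpretationP I) xD xD xD.
Qed.

Lemma iota_cover A u : u \in dom I A -> exists a : A, u \in Defs.iota I a.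
Proof.
move=> uD.
have : [set w in dom I A | equ u w] \in
    equivalence_partition (@equ _ _ _ _ _ I A) (dom I A) by apply: imset_f.
rewrite -(iota_image (interpretationP I)) => /imsetP[a _ au]; exists a.
rewrite -au inE uD /=.
by have [->] := equ_equivalence (interpretationP I) uD uD uD.
Qed.

(** Relative to one known representative, being a representative is a condition expressed by [delta]
    and [epsilon], hence by an L-formula. *)
Lemma representsP A m (v w : m.-tuple (r.-tuple (alpha I A))) (b : m.-tuple A) :
  represents v b ->
  represents w b = in_dom w && [forall i, equ (tnth v i) (tnth w i)].
Proof.
move=> /forallP vb; apply/forallP/andP => [wb|[/forallP wD /forallP vw] i].
  by split; apply/forallP => i; have [_ E] := iotaP (vb i);
     have := wb i; rewrite E => /andP[].
by have [_ ->] := iotaP (vb i); rewrite wD vw.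
Qed.

Lemma represents_in_dom A m (v : m.-tuple (r.-tuple (alpha I A))) b :
  represents v b -> in_dom v.
Proof. by move=> /forallP vb; apply/forallP => i; have [] := iotaP (vb i). Qed.

Lemma exists_representative A m (b : m.-tuple A) :
  exists v : m.-tuple (r.-tuple (alpha I A)), represents v b.
Proof.
have [f fP] := choice (fun i => iota_nonempty (tnth b i)).
by exists [tuple f i | i < m]; apply/forallP => i; rewrite tnth_mktuple.
Qed.

Lemma exists_represented A m (v : m.-tuple (r.-tuple (alpha I A))) :
  in_dom v -> exists b : m.-tuple A, represents v b.
Proof.
move=> /forallP vD; have [f fP] := choice (fun i => iota_cover (vD i)).
by exists [tuple f i | i < m]; apply/forallP => i; rewrite tnth_mktuple.
Qed.

Section RepresentativeFormula.
Variable m : nat.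

(* [inl x] is a variable of a block formula in m blocks, and [inr (i, k)] is
   the k-th coordinate of a second representative of the i-th block *)
Let var := ('I_m * 'I_r + 'I_(nparam I) + 'I_m * 'I_r)%type.

Let new (x : 'I_m * 'I_r + 'I_(nparam I)) : var :=
  match x with inl p => inr p | inr c => inl (inr c) end.

Let new_dom i (x : 'I_1 * 'I_r + 'I_(nparam I)) : var :=
  match x with inl p => inr (i, p.2) | inr c => inl (inr c) end.

Let old_new i (x : 'I_2 * 'I_r + 'I_(nparam I)) : var :=
  match x with
  | inl p => if p.1 == ord0 then inl (inl (i, p.2)) else inr (i, p.2)
  | inr c => inl (inr c)
  end.

Let merge (x : var) : 'I_m * 'I_r + 'I_(nparam I) :=
  match x with inl x => x | inr p => inl p end.

(** Quantification takes place in the enlarged variable type; [merge] then returns to block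
    variables, giving the bound coordinates a default value. *)
Definition some_representative (rho : block_formula I m) : block_formula I m :=
  rename merge (FExOf [seq inr p | p <- enum [set: 'I_m * 'I_r]]
    (FAnd (rename new rho) (FAllOf
      [seq FAnd (rename (new_dom i) (delta I)) (rename (old_new i) (epsilon I))
      | i <- enum 'I_m]))).

(** The right-hand side depends on [b] alone, so this saturation turns membership of a cell in the
    profile into an invariant block formula. *)
Lemma block_sat_some_representative rho A (b : m.-tuple A)
    (v : m.-tuple (r.-tuple (alpha I A))) : represents v b ->
  block_sat (some_representative rho) v =
    [exists w : m.-tuple (r.-tuple (alpha I A)),
      represents w b && block_sat rho w].
Proof.
move=> vb; have rep w := representsP w vb.
(* An assignment that extends [v] and the parameters is the same as a second tuple [w]; the formula
   under the quantifiers then says that [w] represents [b] and satisfies [rho]. *)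
have envE (a : var -> alpha I A) (w : m.-tuple (r.-tuple (alpha I A))) :
    (forall x, a (inl x) = block_env v (param I A) x) ->
    (forall i k, a (inr (i, k)) = tnth (tnth w i) k) ->
    sat (FAnd (rename new rho) (FAllOf
      [seq FAnd (rename (new_dom i) (delta I)) (rename (old_new i) (epsilon I))
      | i <- enum 'I_m])) a = represents w b && block_sat rho w.
  move=> al ar; rewrite rep sat_FAnd andbC sat_FAllOf all_map.
  congr andb; last first.
    rewrite sat_rename /block_sat; congr sat; apply: funext => -[[i k]|c] /=.
      exact: ar.
    exact: al.
  have delE i : sat (rename (new_dom i) (delta I)) a = (tnth w i \in dom I A).
    rewrite sat_rename inE /block_sat; congr sat.
    apply: funext => -[[j k]|c] /=.
      by rewrite ar (ord1 j).
    exact: al.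
  have epsE i : sat (rename (old_new i) (epsilon I)) a =
      equ (tnth v i) (tnth w i).
    rewrite sat_rename /equ /= /block_sat; congr sat.
    apply: funext => -[[j k]|c] /=.
      by case: j => -[|[|//]] j2 /=; rewrite ?ar ?al.
    exact: al.
  rewrite (@eq_all _ _
    (fun i => (tnth w i \in dom I A) && equ (tnth v i) (tnth w i))).
    apply/allP/andP => [H|[/forallP wD /forallP vw] i _]; last by rewrite wD vw.
    by split; apply/forallP => i; have /andP[] := H i (mem_enum _ _).
  by move=> i; exact: etrans (sat_FAnd _ _ _) (congr2 andb (delE i) (epsE i)).
rewrite {1}/block_sat sat_rename; apply/idP/existsP.
  case/sat_FExOf => a aE sa.
  exists [tuple [tuple a (inr (i, k)) | k < r] | i < m].
  rewrite -(envE a) // => [x|i k]; last by rewrite !tnth_mktuple.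
  by rewrite aE //; apply/mapP => -[].
case=> w wP; apply/sat_FExOf.
exists (fun x => match x with inl x => block_env v (param I A) x
                 | inr p => tnth (tnth w p.1) p.2 end).
  by move=> [x|p] //= /negP[]; apply: map_f; rewrite mem_enum inE.
by rewrite (envE _ w).
Qed.

End RepresentativeFormula.

End Interpretation.

(** * Quotient-trace reflection implies profile descent *)

Section Descent.
Variables (R : realType) (N : nat) (L L' : language).
Variables (C : class L) (D : class L') (r : nat).
Variable I : interpretation C D r.

(** A universe cell formula mentions the parameters only, so it is a block formula with no blocks,
    and its invariance is trivial. *)
Lemma trace_reflecting_universe_descends (U : universe_partition R N I) :
  quotient_trace_reflecting I -> universe_descends U.
Proof.
move=> reflecting l _.
pose rho : block_formula I 0 := rename inr (chi U l).
have rhoE (A : member D) (v : 0.-tuple (r.-tuple (alpha I A))) :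
    block_sat rho v = univ_cell U l A.
  by rewrite /block_sat sat_rename /univ_cell; congr sat; apply: funext.
have [|sigma sigmaE] := reflecting 0%N rho.
  by move=> A v w _ _ _; rewrite !rhoE.
exists sigma => A; rewrite (sigmaE A _ [tuple]) ?rhoE //.
by apply/forallP => -[].
Qed.

(** Having profile [P] is a Boolean combination of the saturated cell formulas, hence invariant and
    reflected. *)
Lemma trace_reflecting_profiles_descend m (phi : formula L' (option 'I_m))
    (Theta : ambient_partition R N I phi) :
  quotient_trace_reflecting I -> profiles_descend Theta.
Proof.
move=> reflecting P _.
pose rho : block_formula I m := FAllOf
  [seq if i \in P then some_representative (theta i)
       else FNot (some_representative (theta i)) | i <- enum (cell Theta)].
have rhoE (A : member D) (b : m.-tuple A) v : represents v b ->
    block_sat rho v = (profile Theta b == P).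
  move=> vb; rewrite {1}/block_sat sat_FAllOf all_map.
  have cellE i : sat (if i \in P then some_representative (theta i)
      else FNot (some_representative (theta i))) (block_env v (param I A)) =
      ((i \in profile Theta b) == (i \in P)).
    rewrite inE -(block_sat_some_representative (theta i) vb).
    by case: ifP => _; rewrite ?sat_FNot ?eqb_id ?eqbF_neg.
  rewrite (eq_all cellE); apply/allP/eqP => [H|<- //].
  by apply/setP => i; apply/eqP; apply: H; rewrite mem_enum.
have [|psi psiE] := reflecting m rho.
  move=> A v w vD wD vw; have [b vb] := exists_represented vD.
  rewrite (rhoE _ _ _ vb) (rhoE _ b) // (representsP _ vb) wD.
  by apply/forallP.
exists psi => A b; have [v vb] := exists_representative I b.
by rewrite (psiE A b v vb); apply: rhoE.
Qed.

Lemma trace_reflecting_profile_descent (U : universe_partition R N I)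
    (F : ambient_family R N I) :
  quotient_trace_reflecting I -> profile_descent U F.
Proof.
move=> reflecting; split; first exact: trace_reflecting_universe_descends.
by move=> m phi; apply: trace_reflecting_profiles_descend.
Qed.

End Descent.

(** * Denominators *)

Section LcmOverSets.
Variables (A : set nat).
Hypothesis finA : finite_set A.

(** Finiteness matters: over an infinite set of numbers the big operator takes its neutral value
    1. *)
Lemma dvdn_fsbig_lcmn k : A k -> (k %| \big[lcmn/1%N]_(i \in A) i)%N.
Proof.
move=> Ak; rewrite fsbig_finite //=.
have : k \in enum_fset (fset_set A) by rewrite in_fset_set // inE.
elim: (enum_fset _) => //= i s IH; rewrite inE big_cons => /predU1P[->|/IH ks].
  exact: dvdn_lcml.
by rewrite (dvdn_trans ks) ?dvdn_lcmr.
Qed.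

Lemma fsbig_lcmn_dvdn n :
  (forall k, A k -> k %| n)%N -> (\big[lcmn/1%N]_(i \in A) i %| n)%N.
Proof.
move=> An; rewrite fsbig_finite //= big_seq.
elim/big_rec: _ => // k x; rewrite in_fset_set // inE => /An kn xn.
by rewrite dvdn_lcm kn.
Qed.

End LcmOverSets.

Lemma natr_div_eq (F : numFieldType) (a b c d : nat) : (0 < b)%N -> (0 < d)%N ->
  (a%:R / b%:R = c%:R / d%:R :> F) <-> (a * d = c * b)%N.
Proof.
move=> b0 d0; have bF : b%:R != 0 :> F by rewrite pnatr_eq0 -lt0n.
have dF : d%:R != 0 :> F by rewrite pnatr_eq0 -lt0n.
split=> [/eqP|E]; first by rewrite eqr_div // -!natrM eqr_nat => /eqP.
by apply/eqP; rewrite eqr_div // -!natrM E.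
Qed.

(** With [g = gcdn d e], the number [e / g] divides [(d / g) * e'] and is coprime to [d / g], so
    Gauss's lemma applies. *)
Lemma reduced_denominator_dvdn (d e d' e' : nat) : (0 < e)%N ->
  (d * e' = d' * e)%N -> (e %/ gcdn d e %| e')%N.
Proof.
move=> e0 E; have g0 : (0 < gcdn d e)%N by rewrite gcdn_gt0 e0 orbT.
have cop : coprime (e %/ gcdn d e) (d %/ gcdn d e).
  by rewrite coprime_sym /coprime -(eqn_pmul2r g0) muln_gcdl mul1n
    !divnK ?dvdn_gcdl ?dvdn_gcdr.
rewrite -(Gauss_dvdr _ cop) -(dvdn_pmul2r g0) mulnAC.
rewrite !divnK ?dvdn_gcdl ?dvdn_gcdr //.
by rewrite E dvdn_mull.
Qed.

(** * Exponents of universe cells and visible denominators *)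

Section Main.
Variables (R : realType) (N : nat) (N_gt0 : (0 < N)%N) (L L' : language).
Variables (C : class L) (D : class L') (r : nat).
Variables (I : interpretation C D r) (U : universe_partition R N I).
Variable (F : ambient_family R N I).

Notation card_of m := (fun t : {A : member D & m.-tuple A} => #|projT1 t|).

Lemma valid_label_cases (n : nat) (l : nat * R) :
  valid_label n l -> 0 < l.2 /\ (l.1 <= n)%N \/ l = (0%N, 0).
Proof. by case/orP=> [/andP[]|/eqP]; [left|right]. Qed.

Lemma univ_label_gt0 e lambda :
  (e, lambda) \in univ_labels U -> (0 < e)%N -> 0 < lambda.
Proof.
move=> eU; have := allP (univ_labels_valid U) _ eU.
case/valid_label_cases=> [[]//|[-> _]].
by rewrite ltnn.
Qed.

Lemma E_Q_le e : E_Q U e -> (0 < e <= N * r)%N.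
Proof.
case=> e0 [lambda [lambda0 eU _]]; rewrite e0.
have := allP (univ_labels_valid U) _ eU.
by case/valid_label_cases=> [[]|[->]].
Qed.

Lemma finite_E_Q : finite_set (E_Q U).
Proof.
apply: sub_finite_set (finite_II (N * r).+1) => e /E_Q_le /andP[_ le_e] /=.
by rewrite ltnS.
Qed.

Lemma occurs_E_Q d e : occurs U F d e -> E_Q U e.
Proof.
case=> m [phi [lambda [mu [P [[e0 eU] _ uJ _ _]]]]]; split=> //; exists lambda.
split=> // [|K]; first exact: univ_label_gt0 eU e0.
by have [t [Ut _] Kt] := uJ K; exists (projT1 t).
Qed.

Lemma L_Q_gt0 : (0 < L_Q U)%N.
Proof.
rewrite /L_Q fsbig_finite /=; last exact: finite_E_Q.
rewrite big_seq; elim/big_rec: _ => // e x.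
rewrite in_fset_set; last exact: finite_E_Q.
by rewrite inE => /E_Q_le /andP[e0 _] x0; rewrite lcmn_gt0 e0.
Qed.

(** The pair [(d, e)] may differ from the pair [(d', e')] that occurs, but both present the same
    rational, whose reduced denominator divides [e']. *)
Lemma visible_denominator_dvdn d e : (0 < e)%N -> Sigma_I U F (d%:R / e%:R) ->
  exists2 e', E_Q U e' & (e %/ gcdn d e %| e')%N.
Proof.
move=> e0 [d' [e' [occ E]]]; exists e'; first exact: occurs_E_Q occ.
have /E_Q_le/andP[e'0 _] := occurs_E_Q occ.
by apply: (@reduced_denominator_dvdn d e d') => //; apply/(natr_div_eq rat).
Qed.

Lemma finite_visible_denominators :
  finite_set [set k | exists d e : nat,
    [/\ (0 < e)%N, Sigma_I U F (d%:R / e%:R) & k = (e %/ gcdn d e)%N]]%classic.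
Proof.
apply: sub_finite_set (finite_II (N * r).+1) => k [d [e [e0 dS ->]]] /=.
have [e' /E_Q_le/andP[e'0 e'_le] ke'] := visible_denominator_dvdn e0 dS.
by rewrite ltnS (leq_trans (dvdn_leq e'0 ke')).
Qed.

(** By coprimality each [e] in [E_Q] is itself a visible denominator; conversely each visible
    denominator divides an element of [E_Q]. *)
Lemma L_Q_eq_L_vis :
  (forall e : nat, E_Q U e ->
     exists d : nat, Sigma_I U F (d%:R / e%:R) /\ gcdn d e = 1%N) ->
  L_Q U = L_vis U F.
Proof.
move=> coprime_exponents; apply/eqP; rewrite eqn_dvd; apply/andP; split.
  apply: (fsbig_lcmn_dvdn finite_E_Q) => e eE.
  apply: (dvdn_fsbig_lcmn finite_visible_denominators).
  have [d [dS de]] := coprime_exponents e eE.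
  by exists d, e; rewrite de divn1; have /andP[] := E_Q_le eE.
apply: (fsbig_lcmn_dvdn finite_visible_denominators) => k [d [e [e0 dS ->]]].
have [e' e'E ke'] := visible_denominator_dvdn e0 dS.
exact: dvdn_trans ke' (dvdn_fsbig_lcmn finite_E_Q e'E).
Qed.

(** Elements of [A] correspond to distinct sets of [r]-tuples. This crude power-set bound suffices
    for [ambient_diverges]. *)
Lemma card_le_ambient (A : member D) : (#|A| <= 2 ^ (#|alpha I A| ^ r))%N.
Proof.
rewrite -(card_tuple r) -[X in (_ ^ X)%N]cardsT -card_powerset powersetT cardsT.
exact: leq_card (@iota_inj _ _ _ _ _ _ (interpretationP I) A).
Qed.

Lemma ambient_diverges (m : nat) (Phi : {A : member D & m.-tuple A} -> Prop) :
  diverges_with (fun t => #|alpha I (projT1 t)|) (fun t => #|projT1 t|) Phi.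
Proof.
move=> Q; exists (2 ^ (Q ^ r))%N => t _ Qt; rewrite ltnNge; apply/negP => tQ.
move: Qt; rewrite ltnNge (leq_trans (card_le_ambient _)) //.
rewrite leq_pexp2l //; move: (#|_|) tQ => M MQ.
by case: (posnP r) => [->|r0]; [rewrite !expn0 | rewrite leq_exp2r].
Qed.

(** * Growth on joint cells *)

Section JointCells.
Variables (m : nat) (phi : formula L' (option 'I_m)).
Implicit Types (u : nat * R) (P : {set cell (F phi)}).

Definition joint_cell u P (t : {A : member D & m.-tuple A}) : Prop :=
  univ_cell U u (projT1 t) /\ profile (F phi) (projT2 t) = P.

(** Any single [i] in the profile supplies an estimate on the whole joint cell. The solutions lie in
    [A], so the exponent of [label i] is at most [e], as the change of scale from [n] to [|A|]
    requires. *)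
Lemma joint_cell_grows_like e lambda P i :
  (e, lambda) \in univ_labels U -> i \in P ->
  unbounded (card_of m)
    (joint_cell (e, lambda) P) ->
  [/\ E_Q U e, (label i).1 <= e &
    grows_like (card_of m)
      (joint_cell (e, lambda) P) (fun t => #|solutions phi (projT2 t)|)
      ((label i).1%:R / e%:R)
      ((label i).2 * lambda `^ (- ((label i).1%:R / e%:R)))]%N.
Proof.
move=> eU iP uJ; set J := joint_cell _ _ in uJ *.
pose n := fun t : {A : member D & m.-tuple A} => #|alpha I (projT1 t)|.
have nk : diverges_with n (fun t => #|projT1 t|) J by exact: ambient_diverges.
have uJn := diverges_with_unbounded nk uJ.
have gA : grows_like n J (fun t => #|projT1 t|) (e%:R / N%:R) lambda.
  move=> eps eps0; have [Q QP] := univ_cell_asymptotic eU eps0.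
  by exists Q => t [Ut _]; apply: (QP (projT1 t)).
have gf : grows_like n J (fun t => #|solutions phi (projT2 t)|)
    ((label i).1%:R / N%:R) (label i).2.
  apply: little_o_sub (@theta_asymptotic _ _ _ _ _ _ _ _ _ _ (F phi) i).
  move=> t [_ tP].
  by move: iP; rewrite -tP inE => /existsP[v /andP[vb vi]]; exists v.
have e0 : (0 < e)%N.
  rewrite lt0n; apply/eqP => e0; move: gA; rewrite e0 mul0r => gA.
  exact: (grows_like_const_bounded nk gA uJ).
have lambda0 := univ_label_gt0 eU e0.
have N0 : 0 < N%:R :> R by rewrite ltr0n.
have eN0 : 0 < e%:R / N%:R :> R by rewrite divr_gt0 ?ltr0n.
have mu0 : 0 <= (label i).2.
  by have /valid_label_cases[[/ltW]|->] := label_valid i.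
have de : ((label i).1 <= e)%N.
  (* For the label (0, 0) the inequality is trivial; otherwise the positive coefficient allows
     exponents to be compared. *)
  have /valid_label_cases[[mu_gt0 _]|->//] := label_valid i.
  rewrite -(ler_nat R) -(@ler_pM2r _ N%:R^-1) ?invr_gt0 //.
  apply: (le_exponent uJn _ mu_gt0 (ltW lambda0) gf gA) => t _.
  exact: max_card.
split=> //.
  split=> //; exists lambda; split=> // K.
  by have [t [Ut _] Kt] := uJ K; exists (projT1 t).
have -> : (label i).1%:R / e%:R = (label i).1%:R / N%:R / (e%:R / N%:R) :> R.
  by field; rewrite !pnatr_eq0 -!lt0n N_gt0 e0.
apply: (grows_like_change_scale _ eN0 mu0 lambda0 nk gf gA).
by rewrite divr_ge0 //= ler_pM2r ?invr_gt0 // ler_nat.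
Qed.

Lemma joint_cell_label u P : u \in univ_labels U -> P != finset.set0 ->
  exists2 l : nat * R, valid_label (L_Q U) l &
    asymptotic_to (card_of m)
      (joint_cell u P) (fun t => #|solutions phi (projT2 t)|) (L_Q U) l.
Proof.
case: u => e lambda eU /finset.set0Pn[i iP].
have [uJ|bJ] := pselect (unbounded
    (card_of m) (joint_cell (e, lambda) P)).
  have [eE de gf] := joint_cell_grows_like eU iP uJ.
  have /andP[e0 _] := E_Q_le eE.
  have eL : (e %| L_Q U)%N := dvdn_fsbig_lcmn finite_E_Q eE.
  (* Since [e] divides [L_Q], the exponent [d / e] is rewritten with denominator [L_Q]. *)
  exists (((label i).1 * (L_Q U %/ e))%N,
          (label i).2 * lambda `^ (- ((label i).1%:R / e%:R))).
    have /valid_label_cases[[mu0 _]|->] := label_valid i; last first.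
      by rewrite /valid_label mul0n mul0r eqxx orbT.
    have lambda0 := univ_label_gt0 eU e0.
    rewrite /valid_label /= mulr_gt0 ?powR_gt0 // -{2}(divnK eL).
    by rewrite mulnC leq_mul.
  rewrite /asymptotic_to /=.
  rewrite (_ : _ / (L_Q U)%:R = (label i).1%:R / e%:R) //.
  by apply/natr_div_eq => //; [exact: L_Q_gt0 | rewrite -mulnA divnK].
by exists (0%N, 0); [rewrite /valid_label eqxx orbT | exact: little_o_bounded].
Qed.

End JointCells.

(** * The dimension [L_Q] is attained and is minimal *)

Lemma profile_neq0 m (phi : formula L' (option 'I_m)) (A : member D)
    (b : m.-tuple A) : profile (F phi) b != finset.set0.
Proof.
have [v vb] := exists_representative I b.
have [i [vi _]] := theta_partition (F phi) (represents_in_dom vb).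
apply/finset.set0Pn; exists i; rewrite inE; apply/existsP; exists v.
by rewrite vb.
Qed.

Lemma profile_descent_asymptotic_class :
  profile_descent U F -> asymptotic_class R (L_Q U) D.
Proof.
move=> [Udesc Fdesc] m phi.
pose inU (p : (nat * R) * {set cell (F phi)}) :=
  (p.1 \in univ_labels U) && (p.2 != finset.set0).
(* Labels, and then defining formulas, are chosen for all pairs, with junk values outside [inU]. *)
have /choice[lab labP] : forall p, exists l : nat * R,
    inU p -> valid_label (L_Q U) l /\
      asymptotic_to (card_of m)
        (joint_cell p.1 p.2) (fun t => #|solutions phi (projT2 t)|)
        (L_Q U) l.
  move=> p; have [/andP[pU p0]|_] := boolP (inU p).
    by have [l l_valid lP] := joint_cell_label pU p0; exists l.
  by exists (0%N, 0).
have /choice[psi psiP] : forall p, exists psi : formula L' 'I_m,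
    inU p -> forall (A : member D) (b : m.-tuple A),
      sat psi (tnth b) = univ_cell U p.1 A && (profile (F phi) b == p.2).
  move=> p; have [/andP[pU p0]|_] := boolP (inU p); last first.
    by exists (FFalse _ _).
  have [sigma sigmaP] := Udesc _ pU; have [psi psiP] := Fdesc _ _ _ p0.
  pose no_var (i : 'I_0) : 'I_m := False_rect _ (notF (ltn_ord i)).
  exists (FAnd (rename no_var sigma) psi).
  move=> _ A b; rewrite sat_FAnd psiP sat_rename -sigmaP; congr (sat _ _ && _).
  by apply: funext => -[].
pose cells := [seq p <- [seq (u, P) | u <- univ_labels U,
  P <- enum {set cell (F phi)}] | inU p].
have cellsP p : (p \in cells) = inU p.
  rewrite mem_filter andb_idr // => /andP[pU _]; apply/allpairsP.
  by exists p; rewrite pU mem_enum; case: p {pU}.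
(* Distinct joint cells may share a label, whereas the partition is indexed by labels; hence the
   disjunction. *)
pose theta l := FOneOf [seq psi p | p <- cells & lab p == l].
have thetaP l (A : member D) (b : m.-tuple A) :
    reflect (exists2 p, inU p & lab p = l /\ joint_cell p.1 p.2 (existT _ A b))
      (sat (theta l) (tnth b)).
  rewrite sat_FOneOf has_map; apply: (iffP hasP) => [[p]|[p pU [pl [pA pb]]]].
    rewrite mem_filter cellsP => /andP[/eqP pl pU] /=.
    by rewrite psiP // => /andP[pA /eqP pb]; exists p.
  exists p; first by rewrite mem_filter cellsP pl eqxx.
  by rewrite /= psiP // pA; apply/eqP.
exists [seq lab p | p <- cells], theta; split.
- by apply/allP => l /mapP[p]; rewrite cellsP => /labP[] ? _ ->.
(* The universe cell of [A] and the profile of [b] determine the joint cell, hence its label. *)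
- move=> A b; have [u [[uU uA] u_uniq]] := univ_cell_partition U A.
  pose p := (u, profile (F phi) b).
  have pU : inU p by rewrite /inU uU profile_neq0.
  exists (lab p); split.
    split; first by apply/mapP; exists p; rewrite ?cellsP.
    by apply/thetaP; exists p.
  move=> l [_ /thetaP[[u' P] /andP[u'U _] [<- [u'A /= PE]]]].
  by rewrite /p PE (u_uniq u').
move=> l /mapP[p _ _].
apply: (@little_o_union _ _ _ [seq p <- cells | lab p == l]
    (fun p => joint_cell p.1 p.2)) => [[A b] /thetaP[q qU [ql qJ]]|q].
  by exists q => //; rewrite mem_filter ql eqxx cellsP.
by rewrite mem_filter cellsP => /andP[/eqP <- /labP[]].
Qed.

(** The finitely many cells of an [h]-dimensional partition cut the joint cell into pieces, one of
    which is unbounded. There the exponents [d / e] and [d1 / h] describe the same counting function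
    and must agree. *)
Lemma occurs_denominator h d e : (0 < h)%N -> asymptotic_class R h D ->
  occurs U F d e -> exists d1 : nat, (d * h = d1 * e)%N.
Proof.
move=> h0 hD occ; have /E_Q_le/andP[e0 _] := occurs_E_Q occ.
case: occ => m [phi [lambda [mu [P [[_ eU] P0 uJ Plab mu0]]]]].
have /finset.set0Pn[i iP] := P0.
have [eE _] := joint_cell_grows_like eU iP uJ; rewrite (Plab i iP) /=.
set c := mu * _ => gf.
have c0 : 0 < c.
  by rewrite mulr_gt0 // powR_gt0 // (univ_label_gt0 eU).
have [labels [theta [lab_valid lab_part lab_asym]]] := hD m phi.
have [|[d1 mu1] lD ul] := unbounded_pigeonhole (s := labels)
    (Psi := fun l t => sat (theta l) (tnth (projT2 t))) _ uJ.
  move=> t _; have [l [[lD tl] _]] := lab_part (projT1 t) (projT2 t).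
  by exists l.
pose J t :=
  joint_cell (e, lambda) P t /\ sat (theta (d1, mu1)) (tnth (projT2 t)).
have {}ul : unbounded (card_of m) J by [].
have g1 := little_o_sub (Phi := J) (fun t => @proj2 _ _) (lab_asym _ lD).
have {}gf := little_o_sub (Phi := J) (fun t => @proj1 _ _) gf.
exists d1; apply/(natr_div_eq R) => //; apply/eqP; rewrite eq_le.
have /valid_label_cases[[/= mu10 _]|[d10 mu10]] := allP lab_valid _ lD.
  rewrite (le_exponent ul _ c0 (ltW mu10) gf g1) //.
  by rewrite (le_exponent ul _ mu10 (ltW c0) g1 gf).
(* For the label (0, 0) only the upper bound on [d / e] needs growth; the reverse inequality is
   [0 <= d / e]. *)
rewrite (le_exponent ul _ c0 _ gf g1) ?mu10 //.
by rewrite d10 mul0r divr_ge0.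
Qed.

Lemma L_Q_dvdn h : (0 < h)%N -> asymptotic_class R h D ->
  (forall e : nat, E_Q U e ->
     exists d : nat, Sigma_I U F (d%:R / e%:R) /\ gcdn d e = 1%N) ->
  (L_Q U %| h)%N.
Proof.
move=> h0 hD coprime_exponents; apply: (fsbig_lcmn_dvdn finite_E_Q) => e eE.
have /andP[e0 _] := E_Q_le eE.
have [d [[d' [e' [occ E]]] de]] := coprime_exponents e eE.
have /E_Q_le/andP[e'0 _] := occurs_E_Q occ.
have [d1 d1E] := occurs_denominator h0 hD occ.
have {}E : (d * e' = d' * e)%N by apply/(natr_div_eq rat).
have := @reduced_denominator_dvdn d e d1 h e0; rewrite de divn1; apply.
(* After multiplication by [e'], the relations [d e' = d' e] and [d' h = d1 e'] give
   [d h = d1 e]. *)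
by apply/eqP; rewrite -(eqn_pmul2r e'0) mulnAC E mulnAC d1E mulnAC.
Qed.

End Main.

Theorem corollary8p13 (R : realType) (N : nat) (N_gt0 : (0 < N)%N)
    (L L' : language) (C : class L) (D : class L')
    (C_asymptotic : asymptotic_class R N C)
    (r : nat) (r_gt0 : (0 < r)%N) (I : interpretation C D r)
    (U : universe_partition R N I) (F : ambient_family R N I)
    (descent : quotient_trace_reflecting I \/ profile_descent U F)
    (coprime_exponents : forall e : nat, E_Q U e ->
       exists d : nat, Sigma_I U F (d%:R / e%:R) /\ gcdn d e = 1%N) :
  L_Q U = L_vis U F /\ least_asymptotic_denominator R D (L_Q U).
Proof.
have UF_descent : profile_descent U F.
  by case: descent => // /(@trace_reflecting_profile_descent R N).
split; first exact: L_Q_eq_L_vis.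
split; [exact: L_Q_gt0 | exact: profile_descent_asymptotic_class UF_descent | ].
by move=> h h0 hD; apply/dvdn_leq/(L_Q_dvdn N_gt0 h0 hD coprime_exponents).
Qed.
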